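(* Let $D>0$ be an integer that is not a perfect square and let $k$ be a nonzero integer. Let $u+v\sqrt{D}$ be an element of $\mathbb{Z}_1(\sqrt{D})\setminus\{-1,1\}$. Let $s_0+t_0\sqrt{D}\in\mathbb{Z}_k(\sqrt{D})$. For each integer $n\ge 0$ define integers $s_n,t_n$ by $s_n+t_n\sqrt{D}=(s_0+t_0\sqrt{D})\cdot(u+v\sqrt{D})^n$. Then both sequences $(s_n:n\ge 0)$ and $(t_n:n\ge0)$ are strong Benford sequences.
   Context: For a positive non-square integer $D$, $\mathbb{Z}(\sqrt{D})=\{a+b\sqrt{D}:a,b\in\mathbb{Z}\}$; the norm of $a+b\sqrt{D}$ is $a^2-Db^2$, and $\mathbb{Z}_k(\sqrt{D})$ is the set of elements of norm $k$. For a nonzero real number $x$ and $j\ge1$, $D_j(x)$ denotes the $j$-th most significant decimal digit of $|x|$ (so $D_1(x)\in\{1,\dots,9\}$ is the leading nonzero digit). A sequence $(s_n)$ of real numbers is a strong Benford sequence if every $s_n\neq0$ and for every positive integer $m$, every $d_1\in\{1,\dots,9\}$ and every $d_2,\dots,d_m\in\{0,\dots,9\}$, $$\lim_{N\to\infty}\frac{|\{1\le n\le N: D_j(s_n)=d_j \text{ for } 1\le j\le m\}|}{N}=\log_{10}\Big(1+\frac{1}{\sum_{j=1}^m 10^{m-j}d_j}\Big).$$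
   Formalization: A term may vanish (D=2, unit 3+2√2, start 1 gives t_0=0), so ''every term is nonzero'' is replaced by ''all but finitely many''; all digit-frequency limits are proved in general, and each sequence is strong Benford exactly as defined if none of its terms is zero. *)

(* Defs.v *)
From Stdlib Require Import Reals ZArith List Bool.
From Coquelicot Require Import Coquelicot.
Open Scope R_scope.

Definition quad (D a b : Z) : R := IZR a + IZR b * sqrt (IZR D).

(* For non-square D the coordinates a, b are determined by x, so the norm of x
   is well defined. *)
Definition Zsqrt_norm (D k : Z) (x : R) : Prop :=
  exists a b : Z, x = quad D a b /\ (a ^ 2 - D * b ^ 2 = k)%Z.

Definition log10 (x : R) : R := ln x / ln 10.

(* The j-th (j >= 1) most significant decimal digit of |x|: with
   10 ^ e <= |x| < 10 ^ (e + 1), the units digit of |x| * 10 ^ (j - 1 - e).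
   [Int_part] is the floor.  For the junk argument x = 0 every digit is 0, so
   that x = 0 never has a leading digit in {1, ..., 9}. *)
Definition sig_digit (j : nat) (x : R) : Z :=
  let e := Int_part (log10 (Rabs x)) in
  (Int_part (Rabs x * powerRZ 10 (Z.of_nat j - 1 - e)) mod 10)%Z.

Definition has_digits (m : nat) (d : nat -> Z) (x : R) : bool :=
  forallb (fun j => Z.eqb (sig_digit j x) (d j)) (List.seq 1 m).

Definition digit_count (s : nat -> R) (m : nat) (d : nat -> Z) (N : nat) : nat :=
  length (filter (fun n => has_digits m d (s n)) (List.seq 1 N)).

(* Only the values d 1, ..., d m are used. *)
Definition benford_frequencies (s : nat -> R) : Prop :=
  forall (m : nat) (d : nat -> Z),
    (1 <= m)%nat ->
    (1 <= d 1%nat <= 9)%Z ->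
    (forall j : nat, (2 <= j <= m)%nat -> (0 <= d j <= 9)%Z) ->
    is_lim_seq
      (fun N : nat => INR (digit_count s m d N) / INR N)
      (log10 (1 + 1 / sum_n_m (fun j : nat => 10 ^ (m - j) * IZR (d j)) 1 m)).

Definition strong_benford (s : nat -> R) : Prop :=
  (forall n : nat, s n <> 0) /\ benford_frequencies s.

(* [strong_benford] with "every term is nonzero" relaxed to "all but finitely
   many terms are nonzero"; a zero term matches no digit pattern.  Needed because
   quadratic sequences such as the t-coordinates of (3 + 2 sqrt 2) ^ n
   may pass through 0. *)
Definition strong_benford_off_zeros (s : nat -> R) : Prop :=
  (exists n0 : nat, forall n : nat, (n0 <= n)%nat -> s n <> 0) /\
  benford_frequencies s.

(* Main.v *)
Require Import Defs.
From Stdlib Require Import Reals ZArith List Bool Lia Lra.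
From Coquelicot Require Import Coquelicot.
Open Scope R_scope.

(** Write [e] for the unit and [e'] for its conjugate, so [e * e' = 1].  Both coordinates are of the
    form [A e^n + B e'^n] with [A], [B] nonzero, so the increments of their decimal logarithms tend
    to [log10 |e|] or [log10 |e'|], whichever is positive.  This number is irrational: if a power of
    a unit were an integer power of 10, it would be rational of norm 1, hence [1] or [-1].
    A digit pattern is the condition that the decimal logarithm lies in a given arc of [R / Z], so
    it remains to prove equidistribution of a sequence [y] whose increments tend to an irrational
    number [r].  Since the multiples of [r] are dense modulo 1, an arc shorter than [1 / K] is moved
    by suitable shifts of the sequence into [K] disjoint arcs, so it has upper density at most
    [1 / K]; covering gives upper density at most [l] for every arc of length [l], and passing to
    the complementary arc turns this bound into a limit. *)

(** * Counting *)

(** Same shape as [digit_count], so that results on [count] apply to digit counts by conversion. *)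
Definition count (P : nat -> bool) (N : nat) : nat :=
  length (filter P (List.seq 1 N)).

Lemma count_S (P : nat -> bool) (N : nat) :
  count P (S N) = (count P N + if P (S N) then 1 else 0)%nat.
Proof.
unfold count; rewrite seq_S, filter_app, length_app; simpl.
now destruct (P (S N)).
Qed.

Lemma count_le (P : nat -> bool) (N : nat) : (count P N <= N)%nat.
Proof.
induction N as [|N IH]; [easy|]; rewrite count_S; destruct (P (S N)); lia.
Qed.

Lemma count_negb (P : nat -> bool) (N : nat) :
  (count P N + count (fun n => negb (P n)) N = N)%nat.
Proof.
induction N as [|N IH]; [easy|]; rewrite !count_S; destruct (P (S N)); simpl; lia.
Qed.

Lemma count_eventually_orb (P Q1 Q2 : nat -> bool) (n0 N : nat) :
  (forall n, (n0 <= n)%nat -> P n = true -> Q1 n = true \/ Q2 n = true) ->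
  (count P N <= count Q1 N + count Q2 N + n0)%nat.
Proof.
intros H; induction N as [|N IH]; [unfold count; simpl; lia|].
destruct (Nat.le_gt_cases n0 (S N)) as [h|h].
- rewrite !count_S; specialize (H _ h).
  destruct (P (S N)); [|lia].
  destruct (H eq_refl) as [-> | ->]; destruct (Q1 _); lia.
- generalize (count_le P (S N)); lia.
Qed.

(** The shift by k is injective; at most n0 indices are lost at the start and at most k are pushed
    beyond N. *)
Lemma count_shift (P Q : nat -> bool) (n0 k N : nat) :
  (forall n, (n0 <= n)%nat -> P n = true -> Q (n + k)%nat = true) ->
  (count P N <= count Q N + (n0 + k))%nat.
Proof.
intros H.
set (Qk := fun n => Q (n + k)%nat).
assert (h1 : (count P N <= count Qk N + n0)%nat).
{ generalize (count_eventually_orb P Qk (fun _ => false) n0 N).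
  replace (count (fun _ => false) N) with 0%nat.
  - intros h; rewrite Nat.add_0_r in h; apply h; intros n hn hP; left; now apply H.
  - clear; induction N as [|N IH]; [easy|]; rewrite count_S; lia. }
assert (h2 : (count Qk N <= count Q (N + k))%nat).
{ clear; induction N as [|N IH]; [unfold count; simpl; lia|].
  simpl; rewrite !count_S; unfold Qk at 2; simpl; lia. }
assert (h3 : (count Q (N + k) <= count Q N + k)%nat).
{ clear; induction k as [|k IH]; [rewrite Nat.add_0_r; lia|].
  rewrite Nat.add_succ_r, count_S; destruct (Q _); lia. }
lia.
Qed.

(** The fibres of g over 0, ..., K - 1 are disjoint, so their counts add up to at most N. Later g n
    is the cell of the circle that contains the n-th term. *)
Lemma count_fibres (P : nat -> bool) (g : nat -> Z) (K : nat) :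
  (forall i, (i < K)%nat -> exists C, forall N,
     (count P N <= count (fun n => Z.eqb (g n) (Z.of_nat i)) N + C)%nat) ->
  exists C, forall N, (K * count P N <= N + C)%nat.
Proof.
intros H.
(* For the induction on K, the bound N is sharpened to the count of g n < K, which grows by exactly
   one fibre at each step. *)
enough (h : exists C, forall N,
  (K * count P N <= count (fun n => Z.ltb (g n) (Z.of_nat K)) N + C)%nat).
{ destruct h as [C hC]; exists C; intros N; specialize (hC N).
  generalize (count_le (fun n => Z.ltb (g n) (Z.of_nat K)) N); lia. }
induction K as [|K IH]; [exists 0%nat; intros; lia|].
destruct IH as [C hC]; [intros; apply H; lia|].
destruct (H K) as [C' hC']; [lia|].
exists (C + C')%nat; intros N; specialize (hC N); specialize (hC' N).
enough (count (fun n => Z.ltb (g n) (Z.of_nat (S K))) N =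
  count (fun n => Z.ltb (g n) (Z.of_nat K)) N +
  count (fun n => Z.eqb (g n) (Z.of_nat K)) N)%nat by lia.
clear; induction N as [|N IH]; [easy|].
rewrite !count_S, IH.
destruct (Z.ltb_spec (g (S N)) (Z.of_nat (S K))),
  (Z.ltb_spec (g (S N)) (Z.of_nat K)), (Z.eqb_spec (g (S N)) (Z.of_nat K)); lia.
Qed.

(** * Upper density *)

(** A bound on the limit superior of [count P N / N], written without division; the constant C
    absorbs any finite set of indices. *)
Definition upper_density_le (P : nat -> bool) (r : R) : Prop :=
  forall e, 0 < e -> exists C, forall N, INR (count P N) <= (r + e) * INR N + C.

Lemma upper_density_le_orb (P Q1 Q2 : nat -> bool) (r1 r2 : R) (n0 : nat) :
  (forall n, (n0 <= n)%nat -> P n = true -> Q1 n = true \/ Q2 n = true) ->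
  upper_density_le Q1 r1 -> upper_density_le Q2 r2 ->
  upper_density_le P (r1 + r2).
Proof.
intros H h1 h2 e he.
destruct (h1 (e / 2)) as [C1 hC1]; [lra|].
destruct (h2 (e / 2)) as [C2 hC2]; [lra|].
exists (C1 + C2 + INR n0); intros N.
specialize (hC1 N); specialize (hC2 N).
generalize (le_INR _ _ (count_eventually_orb P Q1 Q2 n0 N H)).
rewrite !plus_INR; lra.
Qed.

Lemma upper_density_le_false : upper_density_le (fun _ => false) 0.
Proof.
intros e he; exists 0; intros N.
replace (count _ N) with 0%nat.
- generalize (pos_INR N); simpl; nra.
- induction N as [|N IH]; [easy|]; rewrite count_S; lia.
Qed.

Lemma upper_density_le_eventually (P Q : nat -> bool) (r : R) (n0 : nat) :
  (forall n, (n0 <= n)%nat -> P n = true -> Q n = true) ->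
  upper_density_le Q r -> upper_density_le P r.
Proof.
intros H h; rewrite <- (Rplus_0_r r).
apply (upper_density_le_orb P Q (fun _ => false) r 0 n0); auto.
exact upper_density_le_false.
Qed.

Lemma upper_density_le_approx (P : nat -> bool) (r : R) :
  (forall e, 0 < e -> upper_density_le P (r + e)) -> upper_density_le P r.
Proof.
intros H e he; destruct (H (e / 2) ltac:(lra) (e / 2)) as [C hC]; [lra|].
exists C; intros N; specialize (hC N); lra.
Qed.

(** The two counts add up to N, so an upper bound for the complement is a lower bound for P. *)
Lemma upper_density_le_compl_lim (P : nat -> bool) (r : R) :
  upper_density_le P r -> upper_density_le (fun n => negb (P n)) (1 - r) ->
  is_lim_seq (fun N => INR (count P N) / INR N) r.
Proof.
intros h1 h2; apply is_lim_seq_spec; intros e; simpl.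
assert (he := cond_pos e).
destruct (h1 (e / 2)) as [C1 hC1]; [lra|].
destruct (h2 (e / 2)) as [C2 hC2]; [lra|].
destruct (INR_unbounded (2 * (Rabs C1 + Rabs C2) / e)) as [N0 hN0].
exists (S N0); intros N hN.
assert (hN' : INR N > INR N0) by (apply lt_INR; lia).
assert (0 <= INR N0) by apply pos_INR.
assert (hb : Rabs C1 + Rabs C2 < e / 2 * INR N).
{ apply Rmult_lt_reg_r with (2 / e); [apply Rdiv_lt_0_compat; lra|].
  replace (e / 2 * INR N * (2 / e)) with (INR N) by (field; lra).
  replace ((Rabs C1 + Rabs C2) * (2 / e)) with (2 * (Rabs C1 + Rabs C2) / e)
    by (field; lra); lra. }
specialize (hC1 N); specialize (hC2 N).
assert (h := f_equal INR (count_negb P N)); rewrite plus_INR in h.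
generalize (Rle_abs C1) (Rle_abs C2) (Rabs_pos C1) (Rabs_pos C2); intros.
replace (INR (count P N) / INR N - r) with ((INR (count P N) - r * INR N) / INR N)
  by (field; lra).
rewrite Rabs_div, (Rabs_pos_eq (INR N)) by lra.
apply Rmult_lt_reg_r with (INR N); [lra|].
unfold Rdiv; rewrite Rmult_assoc, Rinv_l, Rmult_1_r by lra.
apply Rabs_def1; nra.
Qed.

(** * Irrational rotations *)

Definition irrational (x : R) : Prop :=
  forall p q : Z, q <> 0%Z -> IZR q * x <> IZR p.

Lemma pigeonhole_nat (f : nat -> nat) (M : nat) :
  (forall j, (j <= M)%nat -> (f j < M)%nat) ->
  exists i j, (i < j)%nat /\ f i = f j.
Proof.
intros H; apply Classical_Prop.NNPP; intros hn.
assert (inj : forall i j, f i = f j -> i = j).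
{ intros i j hij; destruct (Nat.lt_trichotomy i j) as [h|[h|h]]; auto;
  exfalso; apply hn; [exists i, j|exists j, i]; auto. }
assert (h : (length (map f (List.seq 0 (S M))) <= length (List.seq 0 M))%nat).
{ apply NoDup_incl_length.
  - apply NoDup_map_NoDup_ForallPairs; [|apply seq_NoDup].
    intros x y _ _; apply inj.
  - intros x; rewrite in_map_iff; intros [j [<- hj]].
    apply in_seq in hj; apply in_seq; specialize (H j); lia. }
rewrite length_map, !length_seq in h; lia.
Qed.

(** Dirichlet's argument: among M + 1 multiples of x, two have fractional parts in the same interval
    of length 1 / M. Irrationality makes the difference nonzero. *)
Lemma irrational_small_multiple (x e : R) : irrational x -> 0 < e ->
  exists (k : nat) (z : Z), 0 < Rabs (INR k * x - IZR z) < e.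
Proof.
intros hx he.
destruct (INR_unbounded (1 / e)) as [M hM].
assert (hM0 : 0 < INR M).
{ assert (0 < 1 / e) by (apply Rdiv_lt_0_compat; lra); lra. }
set (f := fun j : nat => Z.to_nat (Int_part (INR M * frac_part (INR j * x)))).
assert (hf : forall j, (0 <= Int_part (INR M * frac_part (INR j * x)) < Z.of_nat M)%Z).
{ intros j; destruct (base_fp (INR j * x)) as [h1 h2].
  destruct (base_Int_part (INR M * frac_part (INR j * x))) as [h3 h4].
  split.
  - apply Z.lt_pred_le, lt_IZR; simpl; change (Z.pred 0) with (-1)%Z; nra.
  - apply lt_IZR; rewrite <- INR_IZR_INZ; nra. }
destruct (pigeonhole_nat f M) as [i [j [hij heq]]].
{ intros j _; unfold f; specialize (hf j); lia. }
exists (j - i)%nat, (Int_part (INR j * x) - Int_part (INR i * x))%Z.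
split.
- apply Rabs_pos_lt; intros h.
  apply (hx (Int_part (INR j * x) - Int_part (INR i * x))%Z (Z.of_nat (j - i))).
  + lia.
  + rewrite <- INR_IZR_INZ; lra.
- assert (heq' : Int_part (INR M * frac_part (INR i * x)) =
                 Int_part (INR M * frac_part (INR j * x))).
  { generalize (hf i) (hf j); unfold f in heq; lia. }
  rewrite minus_INR, minus_IZR by lia.
  replace ((INR j - INR i) * x - (IZR (Int_part (INR j * x)) - IZR (Int_part (INR i * x))))
    with (frac_part (INR j * x) - frac_part (INR i * x)) by (unfold frac_part; ring).
  destruct (base_Int_part (INR M * frac_part (INR i * x))) as [h1 h2].
  destruct (base_Int_part (INR M * frac_part (INR j * x))) as [h3 h4].
  rewrite heq' in h1, h2.
  assert (1 < e * INR M).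
  { apply Rmult_lt_reg_r with (/ e); [apply Rinv_0_lt_compat; lra|].
    replace (e * INR M * / e) with (INR M) by (field; lra); lra. }
  apply Rabs_def1; apply Rmult_lt_reg_l with (INR M); nra.
Qed.

(** Some d = k x - z has 0 < |d| < e, and its multiples come within e of every point on their side
    of 0. *)
Lemma irrational_multiples_dense (x a e : R) : irrational x -> 0 < e ->
  exists (k : nat) (z : Z), Rabs (INR k * x - a - IZR z) < e.
Proof.
intros hx he.
destruct (irrational_small_multiple x e hx he) as [k [z [h0 h1]]].
set (d := INR k * x - IZR z) in *.
assert (hd : d <> 0) by (intros h; rewrite h, Rabs_R0 in h0; lra).
(* Only nonnegative multiples of d are available, so a is first moved by an integer w to the side of
   0 on which d lies. *)
assert (hw : exists w : Z, 0 <= (a + IZR w) / d).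
{ destruct (archimed a) as [ha _]; destruct (archimed (- a)) as [hb _].
  destruct (Rtotal_order d 0) as [h|[h|h]]; [|easy|].
  - exists (- up a)%Z; rewrite opp_IZR.
    replace ((a + - IZR (up a)) / d) with ((IZR (up a) - a) / - d) by (field; lra).
    apply Rlt_le, Rdiv_lt_0_compat; lra.
  - exists (up (- a))%Z; apply Rlt_le, Rdiv_lt_0_compat; lra. }
destruct hw as [w hw].
destruct (base_Int_part ((a + IZR w) / d)) as [h2 h3].
set (m := Int_part ((a + IZR w) / d)) in *.
assert (hm : (0 <= m)%Z) by (apply Z.lt_pred_le, lt_IZR; simpl; lra).
exists (Z.to_nat m * k)%nat, (m * z + w)%Z.
rewrite mult_INR, (INR_IZR_INZ (Z.to_nat m)), Z2Nat.id, plus_IZR, mult_IZR by lia.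
replace (IZR m * INR k * x - a - (IZR m * IZR z + IZR w))
  with ((IZR m - (a + IZR w) / d) * d) by (unfold d in *; field; exact hd).
rewrite Rabs_mult.
apply Rle_lt_trans with (1 * Rabs d); [|lra].
apply Rmult_le_compat_r; [lra|]; apply Rabs_le; lra.
Qed.

Lemma is_lim_seq_shift_diff (y : nat -> R) (x : R) (k : nat) :
  is_lim_seq (fun n => y (S n) - y n) x ->
  is_lim_seq (fun n => y (n + k)%nat - y n) (INR k * x).
Proof.
intros H; induction k as [|k IH].
- apply is_lim_seq_ext with (fun _ => 0).
  + intros n; rewrite Nat.add_0_r; ring.
  + simpl; rewrite Rmult_0_l; apply is_lim_seq_const.
- apply is_lim_seq_ext with (fun n => (y (S (n + k)) - y (n + k)%nat) + (y (n + k)%nat - y n)).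
  + intros n; rewrite Nat.add_succ_r; ring.
  + rewrite S_INR, Rmult_plus_distr_r, Rmult_1_l, Rplus_comm.
    apply is_lim_seq_plus'; [|exact IH].
    apply (is_lim_seq_incr_n (fun n => y (S n) - y n) k); exact H.
Qed.

(* The half-open arc [c, c + l) of the circle R / Z. *)
Definition arc (c l y : R) : bool :=
  if Rlt_dec (frac_part (y - c)) l then true else false.

Lemma arcP (c l y : R) : arc c l y = true <-> frac_part (y - c) < l.
Proof. unfold arc; destruct (Rlt_dec _ l); intuition discriminate. Qed.

Lemma frac_part_unique (r f : R) (z : Z) :
  0 <= f < 1 -> r = IZR z + f -> frac_part r = f.
Proof. intros h1 h2; now destruct (Int_part_frac_part_spec r z f h1 h2). Qed.

(** For l at most 1, the integer z can only be the integer part of y - c. *)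
Lemma arc_exists (c l y : R) : l <= 1 ->
  (arc c l y = true <-> exists z : Z, c <= y - IZR z < c + l).
Proof.
intros hl; rewrite arcP; split.
- intros h; exists (Int_part (y - c)).
  destruct (base_fp (y - c)); unfold frac_part in *; lra.
- intros [z hz]; rewrite (frac_part_unique (y - c) (y - c - IZR z) z); lra.
Qed.

(** * Equidistribution modulo 1 when the increments have an irrational limit *)

Section Rotation.

Variables (y : nat -> R) (x : R).
Hypothesis x_irr : irrational x.
Hypothesis y_step : is_lim_seq (fun n => y (S n) - y n) x.

(** The circle is cut into K cells of length 1 / K. For each i, some shift k carries every late
    visit to the arc into a visit to cell i, so each cell is visited at least as often as the arc,
    up to a constant. *)
Lemma upper_density_short_arc (c l : R) (K : nat) :
  (0 < K)%nat -> 0 <= l < 1 / INR K ->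
  upper_density_le (fun n => arc c l (y n)) (1 / INR K).
Proof.
intros hK hl.
assert (hK' : 1 <= INR K) by (apply (le_INR 1); lia).
assert (hK1 : 1 / INR K <= 1).
{ apply Rmult_le_reg_r with (INR K); [lra|].
  unfold Rdiv; rewrite Rmult_assoc, Rinv_l; lra. }
(* Half of the room that the arc leaves in a cell. With cells starting at c - e, the arc is centred
   in the first one and has a margin e on either side. *)
set (e := (1 / INR K - l) / 2).
assert (he : 0 < e) by (unfold e; lra).
destruct (count_fibres (fun n => arc c l (y n))
  (fun n => Int_part (INR K * frac_part (y n - (c - e)))) K) as [C hC].
- intros i hi.
  (* Half of the margin e is spent on k x approximating i / K modulo 1, the other half on y (n + k)
     - y n approximating k x. *)
  destruct (irrational_multiples_dense x (INR i / INR K) (e / 2) x_irr ltac:(lra))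
    as [k [z hz]].
  generalize (is_lim_seq_shift_diff y x k y_step).
  intros hlim; apply is_lim_seq_spec in hlim.
  assert (he2 : 0 < e / 2) by lra.
  destruct (hlim (mkposreal _ he2)) as [n0 hn0]; simpl in hn0.
  exists (n0 + k)%nat; intros N; apply count_shift; intros n hn hP.
  specialize (hn0 n hn).
  apply arc_exists in hP; [|lra]; destruct hP as [w hw].
  apply Rabs_def2 in hz; apply Rabs_def2 in hn0.
  assert (hi0 : 0 <= INR i / INR K).
  { apply Rdiv_le_0_compat; [apply pos_INR|lra]. }
  assert (hi1 : INR i / INR K + 1 / INR K <= 1).
  { apply Rmult_le_reg_r with (INR K); [lra|].
    replace ((INR i / INR K + 1 / INR K) * INR K) with (INR i + 1) by (field; lra).
    rewrite <- S_INR, Rmult_1_l; apply le_INR; lia. }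
  assert (hd : INR i / INR K < y (n + k)%nat - (c - e) - IZR (w + z)
               < INR i / INR K + 1 / INR K).
  { rewrite plus_IZR; unfold e in *; lra. }
  set (f := y (n + k)%nat - (c - e) - IZR (w + z)) in *.
  rewrite (frac_part_unique _ f (w + z)); [|lra|unfold f; ring].
  apply Z.eqb_eq; symmetry; apply Int_part_spec.
  rewrite <- INR_IZR_INZ.
  assert (h1 : INR K * (INR i / INR K) = INR i) by (field; lra).
  assert (h2 : INR K * (1 / INR K) = 1) by (field; lra).
  split; nra.
- intros d hd; exists (INR C); intros N.
  assert (h := le_INR _ _ (hC N)); rewrite mult_INR, plus_INR in h.
  assert (0 <= INR C) by apply pos_INR.
  assert (0 <= INR N) by apply pos_INR.
  assert (0 <= INR (count (fun n => arc c l (y n)) N)) by apply pos_INR.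
  apply Rmult_le_reg_l with (INR K); [lra|].
  replace (INR K * ((1 / INR K + d) * INR N + INR C))
    with (INR N + INR K * d * INR N + INR K * INR C) by (field; lra).
  assert (0 <= INR K * d * INR N) by (apply Rmult_le_pos; [nra|lra]).
  nra.
Qed.

Lemma upper_density_concat (l r : R) (p : nat) :
  0 <= l -> INR p * l <= 1 ->
  (forall c, upper_density_le (fun n => arc c l (y n)) r) ->
  forall c, upper_density_le (fun n => arc c (INR p * l) (y n)) (INR p * r).
Proof.
intros hl hp H c; induction p as [|p IH].
- rewrite !Rmult_0_l.
  apply (upper_density_le_eventually _ (fun _ => false) 0 0); [|exact upper_density_le_false].
  intros n _ h; apply arcP in h; generalize (base_fp (y n - c)); simpl in h; lra.
- rewrite S_INR in *.
  replace ((INR p + 1) * r) with (INR p * r + r) by ring.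
  apply (upper_density_le_orb _ (fun n => arc c (INR p * l) (y n))
           (fun n => arc (c + INR p * l) l (y n)) _ _ 0); [|apply IH; lra|apply H].
  intros n _ h; apply arcP in h.
  destruct (Rlt_le_dec (frac_part (y n - c)) (INR p * l)) as [h1|h1]; [left|right].
  + now apply arcP.
  + apply arcP; destruct (base_fp (y n - c)).
    assert (0 <= INR p * l) by (apply Rmult_le_pos; [apply pos_INR|lra]).
    rewrite (frac_part_unique _ (frac_part (y n - c) - INR p * l) (Int_part (y n - c)));
      [lra|lra|unfold frac_part; ring].
Qed.

(** The arc is cut into p short arcs of upper density at most 1 / K each, where p / K is at most l +
    1 / K < l + e. *)
Lemma upper_density_arc (c l : R) : 0 <= l <= 1 ->
  upper_density_le (fun n => arc c l (y n)) l.
Proof.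
intros hl; apply upper_density_le_approx; intros e he.
destruct (INR_unbounded (1 / e)) as [K hK].
assert (he' : 0 < 1 / e) by (apply Rdiv_lt_0_compat; lra).
assert (hK0 : (0 < K)%nat) by (apply INR_lt; simpl; lra).
assert (hKe : 1 / INR K < e).
{ apply Rmult_lt_reg_r with (INR K); [lra|].
  replace (1 / INR K * INR K) with (e * (1 / e)) by (field; lra).
  apply Rmult_lt_compat_l; lra. }
destruct (base_Int_part (l * INR K)) as [h1 h2].
set (q := Int_part (l * INR K)) in *.
assert (hq : (0 <= q)%Z) by (apply Z.lt_pred_le, lt_IZR; simpl; nra).
(* The least p with l / p < 1 / K, as [upper_density_short_arc] requires of the pieces. *)
set (p := S (Z.to_nat q)).
assert (hp : INR p = IZR q + 1).
{ unfold p; rewrite S_INR, INR_IZR_INZ, Z2Nat.id; auto. }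
assert (hq' : 0 <= IZR q) by now apply IZR_le.
assert (hpl : l = INR p * (l / INR p)) by (field; lra).
apply (upper_density_le_eventually _ (fun n => arc c (INR p * (l / INR p)) (y n)) _ 0).
{ now rewrite <- hpl. }
intros d hd.
destruct (upper_density_concat (l / INR p) (1 / INR K) p) with (c := c) (e := d)
  as [C hC]; auto.
- apply Rdiv_le_0_compat; lra.
- lra.
- intros c'; apply upper_density_short_arc; auto; split.
  + apply Rdiv_le_0_compat; lra.
  + apply Rmult_lt_reg_r with (INR p * INR K); [nra|].
    replace (l / INR p * (INR p * INR K)) with (l * INR K) by (field; lra).
    replace (1 / INR K * (INR p * INR K)) with (INR p) by (field; lra).
    lra.
- exists C; intros N; specialize (hC N).
  assert (0 <= INR N) by apply pos_INR.
  assert (INR p * (1 / INR K) <= l + e).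
  { apply Rmult_le_reg_r with (INR K); [lra|].
    replace (INR p * (1 / INR K) * INR K) with (INR p) by (field; lra).
    assert (1 <= e * INR K).
    { replace 1 with (1 / INR K * INR K) by (field; lra).
      apply Rmult_le_compat_r; lra. }
    lra. }
  nra.
Qed.

(** The complement of [c, c + l) is the arc [c + l, c + 1), of length 1 - l. The indices below n0
    leave room for zero terms, whose logarithm is meaningless. *)
Lemma equidistribution (P : nat -> bool) (c l : R) (n0 : nat) : 0 <= l <= 1 ->
  (forall n, (n0 <= n)%nat -> P n = arc c l (y n)) ->
  is_lim_seq (fun N => INR (count P N) / INR N) l.
Proof.
intros hl hP; apply upper_density_le_compl_lim.
- apply (upper_density_le_eventually _ (fun n => arc c l (y n)) _ n0).
  + intros n hn; now rewrite hP.
  + now apply upper_density_arc.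
- apply (upper_density_le_eventually _ (fun n => arc (c + l) (1 - l) (y n)) _ n0).
  + intros n hn; rewrite hP by easy; rewrite negb_true_iff, arcP; intros h.
    assert (h' : l <= frac_part (y n - c)).
    { apply Rnot_lt_le; intros h'; apply arcP in h'; congruence. }
    destruct (base_fp (y n - c)).
    rewrite (frac_part_unique _ (frac_part (y n - c) - l) (Int_part (y n - c)));
      [lra|lra|unfold frac_part; ring].
  + apply upper_density_arc; lra.
Qed.

End Rotation.

(** * Decimal digits *)

Lemma ln10_pos : 0 < ln 10.
Proof. rewrite <- ln_1; apply ln_increasing; lra. Qed.

Lemma log10_le (a b : R) : 0 < a -> a <= b -> log10 a <= log10 b.
Proof.
intros ha hab; unfold log10; apply Rmult_le_compat_r.
- apply Rlt_le, Rinv_0_lt_compat, ln10_pos.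
- now apply ln_le.
Qed.

Lemma log10_lt (a b : R) : 0 < a -> a < b -> log10 a < log10 b.
Proof.
intros ha hab; unfold log10; apply Rmult_lt_compat_r.
- apply Rinv_0_lt_compat, ln10_pos.
- now apply ln_increasing.
Qed.

Lemma log10_mult (a b : R) : 0 < a -> 0 < b -> log10 (a * b) = log10 a + log10 b.
Proof.
intros ha hb; unfold log10; rewrite ln_mult by easy; field.
apply Rgt_not_eq, ln10_pos.
Qed.

Lemma log10_powerRZ (z : Z) : log10 (powerRZ 10 z) = IZR z.
Proof.
rewrite powerRZ_Rpower by lra; unfold log10, Rpower; rewrite ln_exp; field.
apply Rgt_not_eq, ln10_pos.
Qed.

Lemma log10_pow (n : nat) : log10 (10 ^ n) = INR n.
Proof. now rewrite pow_powerRZ, log10_powerRZ, <- INR_IZR_INZ. Qed.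

(** Horner form of the sum in [benford_frequencies], kept in [Z] for comparison with integer
    parts. *)
Fixpoint decimal (d : nat -> Z) (m : nat) : Z :=
  match m with
  | O => 0
  | S m' => (10 * decimal d m' + d m)%Z
  end.

Lemma decimal_sum (d : nat -> Z) (m : nat) :
  sum_n_m (fun j : nat => 10 ^ (m - j) * IZR (d j)) 1 m = IZR (decimal d m).
Proof.
induction m as [|m IH]; [now rewrite sum_n_m_zero by lia|].
rewrite sum_n_Sm by lia.
rewrite (sum_n_m_ext_loc _ (fun j => mult 10 (10 ^ (m - j) * IZR (d j)))).
- assert (h := sum_n_m_mult_l (K := R_Ring) 10
                 (fun j : nat => 10 ^ (m - j) * IZR (d j)) 1 m).
  rewrite (eq_trans h (f_equal (mult 10) IH)), Nat.sub_diag.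
  change (decimal d (S m)) with (10 * decimal d m + d (S m))%Z.
  rewrite plus_IZR, mult_IZR; unfold plus, mult; simpl; ring.
- intros j hj; replace (S m - j)%nat with (S (m - j)) by lia.
  unfold mult; simpl; ring.
Qed.

(** * Digit patterns as arcs of the circle *)

Section Digits.

Variable d : nat -> Z.
Hypothesis d1 : (1 <= d 1%nat <= 9)%Z.

(** As d 1 is nonzero, the number has exactly m + 1 digits; its logarithm and that of its successor
    then lie in [m, m + 1]. *)
Lemma decimal_bounds (m : nat) :
  (forall j, (2 <= j <= S m)%nat -> (0 <= d j <= 9)%Z) ->
  10 ^ m <= IZR (decimal d (S m)) <= 10 ^ S m - 1.
Proof.
induction m as [|m IH]; intros H.
- change (decimal d 1) with (10 * 0 + d 1%nat)%Z; simpl Z.mul; rewrite Z.add_0_l.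
  destruct d1 as [h1 h2]; apply IZR_le in h1, h2; simpl; lra.
- change (decimal d (S (S m))) with (10 * decimal d (S m) + d (S (S m)))%Z.
  destruct (H (S (S m))) as [h1 h2]; [lia|]; apply IZR_le in h1, h2.
  destruct IH as [h3 h4]; [intros; apply H; lia|].
  rewrite plus_IZR, mult_IZR; change (10 ^ S (S m)) with (10 * 10 ^ S m).
  change (10 ^ S m) with (10 * 10 ^ m) in *; lra.
Qed.

Lemma Int_part_mul10 (a : R) : (Int_part (a * 10) / 10 = Int_part a)%Z.
Proof.
apply Int_part_spec.
destruct (base_Int_part (a * 10)) as [h1 h2].
set (q := Int_part (a * 10)) in *.
generalize (Z_div_mod_eq_full q 10) (Z.mod_pos_bound q 10 ltac:(lia)); intros h3 h4.
assert (h5 : (10 * (q / 10) <= q <= 10 * (q / 10) + 9)%Z) by lia.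
destruct h5 as [h5 h6]; apply IZR_le in h5, h6.
rewrite mult_IZR in h5; rewrite plus_IZR, mult_IZR in h6; lra.
Qed.

(** The quotient of each truncation by 10 is the previous one and the remainder is the new digit. As
    1 <= a < 10, the first truncation is itself a digit. *)
Lemma leading_digits_Int_part (a : R) (m : nat) : 1 <= a < 10 ->
  (forall j, (2 <= j <= S m)%nat -> (0 <= d j <= 9)%Z) ->
  ((forall j, (1 <= j <= S m)%nat -> (Int_part (a * 10 ^ (j - 1)) mod 10)%Z = d j) <->
   Int_part (a * 10 ^ m) = decimal d (S m)).
Proof.
intros ha; induction m as [|m IH]; intros H.
- assert (h : (0 <= Int_part (a * 10 ^ 0) < 10)%Z).
  { simpl; rewrite Rmult_1_r; destruct (base_Int_part a).
    split; [apply Z.lt_pred_le|]; apply lt_IZR; simpl; lra. }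
  replace (decimal d 1) with (d 1%nat) by (simpl decimal; lia).
  rewrite <- (Z.mod_small _ _ h); split.
  + intros h'; apply (h' 1%nat); lia.
  + intros h' j hj; now replace j with 1%nat by lia.
- assert (e : a * 10 ^ S m = a * 10 ^ m * 10) by (simpl; ring).
  assert (h := Int_part_mul10 (a * 10 ^ m)); rewrite <- e in h.
  change (decimal d (S (S m))) with (10 * decimal d (S m) + d (S (S m)))%Z.
  destruct IH as [IH1 IH2]; [intros; apply H; lia|].
  assert (h0 := Z_div_mod_eq_full (Int_part (a * 10 ^ S m)) 10).
  split.
  + intros h'.
    rewrite h0, h, IH1 by (intros; apply h'; lia).
    specialize (h' (S (S m))); simpl Nat.sub in h'; rewrite h' by lia; reflexivity.
  + intros h'.
    assert (hd := H (S (S m)) ltac:(lia)).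
    assert (hm := Z.mod_pos_bound (Int_part (a * 10 ^ S m)) 10 ltac:(lia)).
    assert (hq : Int_part (a * 10 ^ m) = decimal d (S m)) by lia.
    intros j hj; destruct (Nat.eq_dec j (S (S m))) as [->|hj'].
    * simpl Nat.sub; lia.
    * apply IH2; [exact hq|lia].
Qed.

(** With a = |x| / 10^e in [1, 10) and M the prescribed number, the pattern says M <= a 10^m < M +
    1. Taking logarithms places log10 |x| - (e - m) in [log10 M, log10 (M + 1)). *)
Lemma has_digits_arc (x : R) (m : nat) : x <> 0 ->
  (forall j, (2 <= j <= S m)%nat -> (0 <= d j <= 9)%Z) ->
  has_digits (S m) d x =
  arc (log10 (IZR (decimal d (S m))))
      (log10 (1 + 1 / IZR (decimal d (S m)))) (log10 (Rabs x)).
Proof.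
intros hx H.
destruct (decimal_bounds m H) as [hM1 hM2].
set (M := decimal d (S m)) in *.
assert (hp : 1 <= 10 ^ m) by (apply pow_R1_Rle; lra).
assert (hx' : 0 < Rabs x) by now apply Rabs_pos_lt.
assert (hl : log10 (IZR M) + log10 (1 + 1 / IZR M) = log10 (IZR M + 1)).
{ rewrite <- log10_mult; [f_equal; field; lra|lra|].
  apply Rplus_lt_0_compat; [lra|apply Rdiv_lt_0_compat; lra]. }
assert (hlo : INR m <= log10 (IZR M)).
{ rewrite <- log10_pow; apply log10_le; lra. }
assert (hhi : log10 (IZR M + 1) <= INR m + 1).
{ rewrite <- S_INR, <- log10_pow; apply log10_le; lra. }
set (e := Int_part (log10 (Rabs x))).
destruct (base_Int_part (log10 (Rabs x))) as [he1 he2]; fold e in he1, he2.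
set (a := Rabs x * powerRZ 10 (- e)).
assert (hpe : 0 < powerRZ 10 (- e)) by (apply powerRZ_lt; lra).
assert (ha0 : 0 < a) by now apply Rmult_lt_0_compat.
assert (hla : log10 a = log10 (Rabs x) - IZR e).
{ unfold a; rewrite log10_mult, log10_powerRZ, opp_IZR by easy; ring. }
assert (log10_1 : log10 1 = 0) by (unfold log10; rewrite ln_1; unfold Rdiv; ring).
assert (log10_10 : log10 10 = 1).
{ replace 10 with (10 ^ 1) by ring; now rewrite log10_pow. }
assert (ha : 1 <= a < 10).
{ split; [apply Rnot_lt_le|apply Rnot_le_lt]; intros h.
  - apply log10_lt in h; lra.
  - apply log10_le in h; lra. }
assert (hsig : forall j, (1 <= j)%nat ->
   sig_digit j x = (Int_part (a * 10 ^ (j - 1)) mod 10)%Z).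
{ intros j hj; unfold sig_digit; fold e; do 2 f_equal.
  unfold a; rewrite Rmult_assoc; f_equal.
  rewrite pow_powerRZ, <- powerRZ_add by lra; f_equal; lia. }
apply eq_true_iff_eq; rewrite arc_exists by lra.
transitivity (Int_part (a * 10 ^ m) = M).
{ unfold M; rewrite <- (leading_digits_Int_part a m ha H).
  unfold has_digits; rewrite forallb_forall; split.
  - intros h j hj; rewrite <- hsig by lia; apply Z.eqb_eq, h, in_seq; lia.
  - intros h j hj; apply in_seq in hj; apply Z.eqb_eq; rewrite hsig by lia.
    apply h; lia. }
assert (ham : log10 (a * 10 ^ m) = log10 (Rabs x) - IZR e + INR m).
{ rewrite log10_mult, log10_pow; lra. }
assert (ham0 : 0 < a * 10 ^ m) by (apply Rmult_lt_0_compat; lra).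
rewrite hl; split.
- intros h; destruct (base_Int_part (a * 10 ^ m)) as [h1 h2]; rewrite h in h1, h2.
  exists (e - Z.of_nat m)%Z; rewrite minus_IZR, <- INR_IZR_INZ.
  replace (log10 (Rabs x) - (IZR e - INR m)) with (log10 (a * 10 ^ m)) by lra.
  split; [apply log10_le|apply log10_lt]; lra.
- intros [z hz].
  (* The interval lies within [m, m + 1), so z + m can only be the integer part e of log10 |x|. *)
  assert (hez : (z + Z.of_nat m)%Z = e).
  { apply Int_part_spec; rewrite plus_IZR, <- INR_IZR_INZ; lra. }
  apply (f_equal IZR) in hez; rewrite plus_IZR, <- INR_IZR_INZ in hez.
  symmetry; apply Int_part_spec; split.
  + apply Rplus_lt_reg_r with 1; ring_simplify.
    apply Rnot_le_lt; intros h; apply log10_le in h; lra.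
  + apply Rnot_lt_le; intros h; apply log10_lt in h; lra.
Qed.

End Digits.

(** The arc of a pattern with number M has length log10 (1 + 1 / M), which is its Benford
    frequency. *)
Lemma benford_of_log10_step (x : nat -> R) (r : R) (n0 : nat) :
  (forall n, (n0 <= n)%nat -> x n <> 0) -> irrational r ->
  is_lim_seq (fun n => log10 (Rabs (x (S n))) - log10 (Rabs (x n))) r ->
  benford_frequencies x.
Proof.
intros hx hr hlim [|m] d hm hd1 hd; [lia|].
rewrite decimal_sum.
destruct (decimal_bounds d hd1 m hd) as [h1 h2].
assert (hp : 1 <= 10 ^ m) by (apply pow_R1_Rle; lra).
assert (hi : 0 < 1 / IZR (decimal d (S m)) <= 1).
{ split; [apply Rdiv_lt_0_compat; lra|].
  apply Rmult_le_reg_r with (IZR (decimal d (S m))); [lra|].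
  unfold Rdiv; rewrite Rmult_assoc, Rinv_l; lra. }
apply (equidistribution (fun n => log10 (Rabs (x n))) r hr hlim
         (fun n => has_digits (S m) d (x n)) (log10 (IZR (decimal d (S m)))) _ n0).
- split.
  + replace 0 with (log10 1) by (unfold log10; rewrite ln_1; unfold Rdiv; ring).
    apply log10_le; lra.
  + apply Rle_trans with (log10 (10 ^ 1)); [apply log10_le; lra|].
    rewrite log10_pow; simpl; lra.
- intros n hn; apply has_digits_arc; auto.
Qed.

(** * Dominant exponentials *)

Lemma continuity_pt_ln (a : R) : 0 < a -> continuity_pt ln a.
Proof.
intros ha; apply derivable_continuous_pt.
exists (/ a); now apply derivable_pt_lim_ln.
Qed.

(** Factoring out e^n leaves r n, which tends to A, a nonzero number. So log10 |x n| differs from n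
    log10 |e| by a convergent sequence, and its increments tend to log10 |e|. *)
Lemma benford_dominant (x : nat -> R) (A B e e' : R) :
  e * e' = 1 -> 1 < Rabs e -> A <> 0 -> irrational (log10 (Rabs e)) ->
  (forall n, x n = A * e ^ n + B * e' ^ n) ->
  strong_benford_off_zeros x.
Proof.
intros hee he hA hirr hx.
assert (he0 : e <> 0) by (intros h; rewrite h in hee; lra).
(* This is e' / e, because 1 / e = e'. *)
set (q := e' * e').
assert (hq : Rabs q < 1).
{ assert (hab : Rabs e * Rabs e' = 1) by now rewrite <- Rabs_mult, hee, Rabs_R1.
  assert (Rabs e' < 1) by (generalize (Rabs_pos e'); nra).
  unfold q; rewrite Rabs_mult; generalize (Rabs_pos e'); nra. }
set (r := fun n => A + B * q ^ n).
assert (hr : forall n, x n = r n * e ^ n).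
{ intros n; rewrite hx; unfold r, q.
  rewrite Rmult_plus_distr_r, Rmult_assoc; f_equal; f_equal.
  rewrite <- Rpow_mult_distr; f_equal.
  rewrite Rmult_assoc, (Rmult_comm e' e), hee; ring. }
assert (hlim : is_lim_seq r A).
{ unfold r; replace (Finite A) with (Finite (A + B * 0)) by (f_equal; ring).
  apply is_lim_seq_plus'; [apply is_lim_seq_const|].
  apply is_lim_seq_mult'; [apply is_lim_seq_const|now apply is_lim_seq_geom]. }
assert (hA' : 0 < Rabs A) by now apply Rabs_pos_lt.
assert (hr0 : exists n0, forall n, (n0 <= n)%nat -> r n <> 0).
{ apply is_lim_seq_spec in hlim.
  destruct (hlim (mkposreal _ hA')) as [n0 hn0]; simpl in hn0.
  exists n0; intros n hn h; specialize (hn0 n hn).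
  rewrite h, Rminus_0_l, Rabs_Ropp in hn0; lra. }
destruct hr0 as [n0 hn0].
assert (hx0 : forall n, (n0 <= n)%nat -> x n <> 0).
{ intros n hn; rewrite hr; apply Rmult_integral_contrapositive_currified; auto.
  now apply pow_nonzero. }
split; [now exists n0|].
apply (benford_of_log10_step x (log10 (Rabs e)) n0 hx0 hirr).
assert (hlog : is_lim_seq (fun n => log10 (Rabs (r n))) (log10 (Rabs A))).
{ apply (is_lim_seq_div' (fun n => ln (Rabs (r n))) (fun _ => ln 10)).
  - apply is_lim_seq_continuous; [now apply continuity_pt_ln|].
    now apply (is_lim_seq_abs r A).
  - apply is_lim_seq_const.
  - apply Rgt_not_eq, ln10_pos. }
apply is_lim_seq_ext_loc with
  (fun n => log10 (Rabs e) + (log10 (Rabs (r (S n))) - log10 (Rabs (r n)))).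
- exists n0; intros n hn.
  assert (hl : forall i, (n0 <= i)%nat ->
    log10 (Rabs (x i)) = log10 (Rabs (r i)) + INR i * log10 (Rabs e)).
  { intros i hi; rewrite hr, Rabs_mult, <- RPow_abs, log10_mult.
    - f_equal; unfold log10; rewrite ln_pow by lra; unfold Rdiv; ring.
    - now apply Rabs_pos_lt, hn0.
    - apply pow_lt; lra. }
  rewrite !hl, S_INR by lia; ring.
- replace (Finite (log10 (Rabs e)))
    with (Finite (log10 (Rabs e) + (log10 (Rabs A) - log10 (Rabs A))))
    by (f_equal; ring).
  apply is_lim_seq_plus'; [apply is_lim_seq_const|].
  apply is_lim_seq_minus'; auto.
  now apply (is_lim_seq_incr_1 (fun n => log10 (Rabs (r n)))).
Qed.

Lemma irrational_opp (x : R) : irrational x -> irrational (- x).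
Proof.
intros h p q hq hpq; apply (h (- p)%Z q hq); rewrite opp_IZR; lra.
Qed.

Lemma log10_Rabs_inv (e e' : R) : e * e' = 1 -> log10 (Rabs e') = - log10 (Rabs e).
Proof.
intros h.
assert (e <> 0) by (intros h'; rewrite h' in h; lra).
assert (e' <> 0) by (intros h'; rewrite h' in h; lra).
enough (log10 (Rabs e) + log10 (Rabs e') = 0) by lra.
rewrite <- log10_mult, <- Rabs_mult, h, Rabs_R1 by now apply Rabs_pos_lt.
unfold log10; rewrite ln_1; unfold Rdiv; ring.
Qed.

(** The base of absolute value above 1 dominates. Absolute value 1 is excluded, since log10 1 = 0 is
    rational. *)
Lemma benford_two_exponentials (x : nat -> R) (A B e e' : R) :
  e * e' = 1 -> A <> 0 -> B <> 0 -> irrational (log10 (Rabs e)) ->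
  (forall n, x n = A * e ^ n + B * e' ^ n) ->
  strong_benford_off_zeros x.
Proof.
intros hee hA hB hirr hx.
assert (hab : Rabs e * Rabs e' = 1) by now rewrite <- Rabs_mult, hee, Rabs_R1.
destruct (Rtotal_order (Rabs e) 1) as [h|[h|h]].
- apply (benford_dominant x B A e' e); auto.
  + rewrite <- hee; ring.
  + apply Rnot_le_lt; intros h'.
    generalize (Rmult_le_compat_l _ _ _ (Rabs_pos e) h'); lra.
  + rewrite (log10_Rabs_inv e e' hee); now apply irrational_opp.
  + intros n; rewrite hx; ring.
- exfalso; apply (hirr 0%Z 1%Z); [lia|].
  rewrite h; unfold log10; rewrite ln_1; unfold Rdiv; simpl; ring.
- now apply (benford_dominant x A B e e').
Qed.

(** * Quadratic integers *)

(** After division by the greatest common divisor, b' is coprime to a' and divides its square, hence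
    divides a'. *)
Lemma square_dvd_square (a b : Z) : (b * b | a * a)%Z -> (b | a)%Z.
Proof.
intros [c hc].
destruct (Z.eq_dec (Z.gcd a b) 0) as [h|h].
{ apply Z.gcd_eq_0 in h; destruct h as [-> ->]; exists 0%Z; ring. }
destruct (Z.gcd_divide_l a b) as [a' ha], (Z.gcd_divide_r a b) as [b' hb].
set (g := Z.gcd a b) in *.
assert (hg : Z.gcd a' b' = 1%Z).
{ assert (h1 : g = (Z.gcd a' b' * g)%Z).
  { unfold g at 1; rewrite ha, hb, Z.gcd_mul_mono_r, Z.abs_eq; auto.
    apply Z.gcd_nonneg. }
  nia. }
assert (h1 : (a' * a' = c * b' * b')%Z).
{ rewrite ha, hb in hc; nia. }
assert (h2 : (b' | a')%Z).
{ apply Z.gauss with a'; [exists (c * b')%Z; lia|now rewrite Z.gcd_comm]. }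
destruct h2 as [w hw]; exists w; rewrite ha, hb, hw; ring.
Qed.

Section Quad.

Variable D : Z.
Hypothesis D_pos : (0 < D)%Z.
Hypothesis D_nonsquare : ~ exists m : Z, D = (m ^ 2)%Z.

Lemma sqrt_D_sq : sqrt (IZR D) * sqrt (IZR D) = IZR D.
Proof. apply sqrt_sqrt, IZR_le; lia. Qed.

(** Irrationality of sqrt D: a^2 = D b^2 with b nonzero forces b to divide a, and then D is the
    square of a / b. *)
Lemma quad_eq0 (a b : Z) : quad D a b = 0 -> a = 0%Z /\ b = 0%Z.
Proof.
unfold quad; intros h.
assert (h1 : (a * a = D * (b * b))%Z).
{ apply eq_IZR; rewrite !mult_IZR.
  generalize sqrt_D_sq; revert h; generalize (sqrt (IZR D)); intros r h <-.
  replace (IZR a) with (- (IZR b * r)) by lra; ring. }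
destruct (Z.eq_dec b 0) as [->|hb]; [split; nia|exfalso].
destruct (square_dvd_square a b) as [c hc]; [exists D; lia|].
apply D_nonsquare; exists c; rewrite hc in h1.
apply Z.mul_reg_r with (b * b)%Z; nia.
Qed.

Lemma quad_inj (a b a' b' : Z) : quad D a b = quad D a' b' -> a = a' /\ b = b'.
Proof.
intros h; destruct (quad_eq0 (a - a') (b - b')); [|lia].
unfold quad in *; rewrite !minus_IZR; lra.
Qed.

Lemma Zsqrt_norm_quad (k a b : Z) :
  Zsqrt_norm D k (quad D a b) -> (a * a - D * (b * b) = k)%Z.
Proof.
intros [a' [b' [h hk]]]; apply quad_inj in h; destruct h as [-> ->]; lia.
Qed.

Lemma quad_mul (a b a' b' : Z) :
  quad D a b * quad D a' b' = quad D (a * a' + D * (b * b')) (a * b' + b * a').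
Proof.
unfold quad; rewrite !plus_IZR, !mult_IZR.
generalize sqrt_D_sq; generalize (sqrt (IZR D)); intros r <-; ring.
Qed.

Lemma quad_mul_conj (a b : Z) :
  quad D a b * quad D a (- b) = IZR (a * a - D * (b * b)).
Proof.
unfold quad; rewrite minus_IZR, opp_IZR, !mult_IZR.
generalize sqrt_D_sq; generalize (sqrt (IZR D)); intros r <-; ring.
Qed.

(** Conjugation respects products. It acts on coordinates rather than on real numbers, hence the
    common witnesses a and b. *)
Lemma quad_pow (u v : Z) (n : nat) : exists a b : Z,
  quad D u v ^ n = quad D a b /\ quad D u (- v) ^ n = quad D a (- b).
Proof.
induction n as [|n [a [b [h1 h2]]]].
- exists 1%Z, 0%Z; unfold quad; simpl; split; ring.
- exists (u * a + D * (v * b))%Z, (u * b + v * a)%Z; simpl.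
  rewrite h1, h2, !quad_mul; split; f_equal; ring.
Qed.

(** * Logarithms of units *)

Section Unit.

Variables u v : Z.
Hypothesis unit : (u * u - D * (v * v) = 1)%Z.

Lemma unit_mul_conj : quad D u v * quad D u (- v) = 1.
Proof. now rewrite quad_mul_conj, unit. Qed.

(** A power of the unit equal to 10^p or -10^p has norm 10^(2p) by uniqueness of coordinates, but
    its norm is also 1. *)
Lemma unit_pow_eq_pow10 (p q : nat) :
  Rabs (quad D u v) ^ q = 10 ^ p -> p = 0%nat.
Proof.
intros h.
destruct (quad_pow u v q) as [a [b [h1 h2]]].
assert (hn : quad D a b * quad D a (- b) = 1).
{ rewrite <- h1, <- h2, <- Rpow_mult_distr, unit_mul_conj; apply pow1. }
rewrite quad_mul_conj in hn; apply eq_IZR in hn.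
rewrite RPow_abs, h1 in h.
assert (hp : exists c : Z, quad D a b = quad D c 0 /\ (c * c = 10 ^ Z.of_nat p * 10 ^ Z.of_nat p)%Z).
{ rewrite pow_IZR in h.
  destruct (Rcase_abs (quad D a b)) as [hs|hs].
  - rewrite Rabs_left in h by easy; exists (- 10 ^ Z.of_nat p)%Z; split; [|lia].
    unfold quad in *; rewrite opp_IZR; lra.
  - rewrite Rabs_right in h by easy; exists (10 ^ Z.of_nat p)%Z; split; [|lia].
    unfold quad in *; lra. }
destruct hp as [c [hc hc2]]; apply quad_inj in hc; destruct hc as [-> ->].
destruct p as [|p]; [easy|exfalso].
assert (0 < 10 ^ Z.of_nat p)%Z by (apply Z.pow_pos_nonneg; lia).
rewrite Nat2Z.inj_succ, Z.pow_succ_r in hc2 by lia; nia.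
Qed.

Lemma unit_log10_eq_nat (p q : nat) :
  INR q * log10 (Rabs (quad D u v)) = INR p -> p = 0%nat.
Proof.
intros h.
assert (hu := unit_mul_conj).
assert (h0 : 0 < Rabs (quad D u v)).
{ apply Rabs_pos_lt; intros h0; rewrite h0 in hu; lra. }
apply (unit_pow_eq_pow10 p q), ln_inv; [now apply pow_lt|apply pow_lt; lra|].
rewrite !ln_pow by lra; rewrite <- h; unfold log10; field.
apply Rgt_not_eq, ln10_pos.
Qed.

End Unit.

(** A logarithm p / q makes a power of the unit or of its conjugate equal to 10^|p| in absolute
    value, so p = 0. Then the unit has absolute value 1, so it is 1 or -1. *)
Lemma unit_log10_irrational (u v : Z) :
  (u * u - D * (v * v) = 1)%Z -> quad D u v <> 1 -> quad D u v <> -1 ->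
  irrational (log10 (Rabs (quad D u v))).
Proof.
intros hunit hu1 huN1 p q hq h.
assert (huv := unit_mul_conj u v hunit).
assert (hN : (u * u - D * (- v * - v) = 1)%Z) by lia.
assert (hinv := log10_Rabs_inv _ _ huv).
(* The exponents must be natural numbers; when p and q differ in sign, passing to the conjugate
   negates the logarithm. *)
assert (hp : Z.abs_nat p = 0%nat).
{ assert (hc : INR (Z.abs_nat q) * log10 (Rabs (quad D u v)) = INR (Z.abs_nat p) \/
               INR (Z.abs_nat q) * log10 (Rabs (quad D u (- v))) = INR (Z.abs_nat p)).
  { rewrite hinv, !INR_IZR_INZ, !Nat2Z.inj_abs_nat.
    destruct (Z.abs_spec p) as [[_ ->]|[_ ->]], (Z.abs_spec q) as [[_ ->]|[_ ->]];
      rewrite ?opp_IZR; [left|right|right|left]; lra. }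
  destruct hc as [hc|hc].
  - exact (unit_log10_eq_nat u v hunit _ _ hc).
  - exact (unit_log10_eq_nat u (- v) hN _ _ hc). }
replace p with 0%Z in h by lia.
apply Rmult_integral in h; destruct h as [h|h].
{ now apply eq_IZR in h. }
assert (h0 : 0 < Rabs (quad D u v)).
{ apply Rabs_pos_lt; intros h0; rewrite h0 in huv; lra. }
assert (h1 : Rabs (quad D u v) = 1).
{ apply ln_inv; [easy|lra|].
  unfold log10 in h; apply Rmult_integral in h; rewrite ln_1; destruct h as [h|h]; auto.
  generalize (Rinv_0_lt_compat _ ln10_pos); lra. }
destruct (Rcase_abs (quad D u v)) as [hs|hs];
  [rewrite Rabs_left in h1 by easy|rewrite Rabs_right in h1 by easy]; lra.
Qed.

End Quad.

Lemma strong_benford_of_off_zeros (s : nat -> Z) :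
  strong_benford_off_zeros (fun n => IZR (s n)) ->
  (forall n, s n <> 0%Z) -> strong_benford (fun n => IZR (s n)).
Proof. intros [_ h] hs; split; [intros n; now apply not_0_IZR|exact h]. Qed.

(** Terms can vanish, for instance t 0 = 0 when the start is 1, so the form with all terms nonzero
    is stated conditionally. *)
Theorem theorem4p4 (D k u v s0 t0 : Z) (s t : nat -> Z)
  (D_pos : (0 < D)%Z)
  (D_nonsquare : ~ exists m : Z, D = (m ^ 2)%Z)
  (k_neq0 : k <> 0%Z)
  (unit_norm : Zsqrt_norm D 1 (quad D u v))
  (unit_neq1 : quad D u v <> 1)
  (unit_neqN1 : quad D u v <> -1)
  (start_norm : Zsqrt_norm D k (quad D s0 t0))
  (st_def : forall n : nat,
      quad D (s n) (t n) = quad D s0 t0 * quad D u v ^ n) :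
  (strong_benford_off_zeros (fun n => IZR (s n)) /\
   ((forall n : nat, s n <> 0%Z) -> strong_benford (fun n => IZR (s n)))) /\
  (strong_benford_off_zeros (fun n => IZR (t n)) /\
   ((forall n : nat, t n <> 0%Z) -> strong_benford (fun n => IZR (t n)))).
Proof.
apply (Zsqrt_norm_quad D D_pos D_nonsquare) in unit_norm, start_norm.
assert (hu := unit_mul_conj D D_pos u v unit_norm).
assert (hirr := unit_log10_irrational D D_pos D_nonsquare u v unit_norm unit_neq1 unit_neqN1).
assert (hz := quad_mul_conj D D_pos s0 t0); rewrite start_norm in hz.
apply not_0_IZR in k_neq0.
(* The start and its conjugate have product k, so neither is zero; up to constant factors they are
   the coefficients of the two exponentials. *)
assert (hz0 : quad D s0 t0 <> 0) by (intros h; rewrite h in hz; lra).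
assert (hz0' : quad D s0 (- t0) <> 0) by (intros h; rewrite h in hz; lra).
(* Coordinates are unique, so the defining equation may be conjugated. *)
assert (st_conj : forall n,
  quad D (s n) (- t n) = quad D s0 (- t0) * quad D u (- v) ^ n).
{ intros n; specialize (st_def n).
  destruct (quad_pow D D_pos u v n) as [a [b [h1 h2]]].
  rewrite h1, quad_mul in st_def by easy; rewrite h2, quad_mul by easy.
  apply (quad_inj D D_pos D_nonsquare) in st_def; destruct st_def as [-> ->].
  f_equal; ring. }
assert (hr : 0 < sqrt (IZR D)) by now apply sqrt_lt_R0, IZR_lt.
assert (hs : strong_benford_off_zeros (fun n => IZR (s n))).
(* Half the sum of an element and its conjugate is its first coordinate. *)
{ apply (benford_two_exponentials _ (quad D s0 t0 / 2) (quad D s0 (- t0) / 2)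
           (quad D u v) (quad D u (- v)) hu); [lra|lra|exact hirr|].
  intros n; specialize (st_def n); specialize (st_conj n).
  unfold quad at 1 in st_def; unfold quad at 1 in st_conj.
  rewrite opp_IZR in st_conj; lra. }
assert (ht : strong_benford_off_zeros (fun n => IZR (t n))).
(* The difference of an element and its conjugate, times c, is its second coordinate. *)
{ set (c := / (2 * sqrt (IZR D))).
  assert (hc : c <> 0) by (apply Rinv_neq_0_compat; lra).
  apply (benford_two_exponentials _ (quad D s0 t0 * c) (- quad D s0 (- t0) * c)
           (quad D u v) (quad D u (- v)) hu); [| |exact hirr|].
  - now apply Rmult_integral_contrapositive_currified.
  - apply Rmult_integral_contrapositive_currified; [|easy].
    now apply Ropp_neq_0_compat.
  - intros n; specialize (st_def n); specialize (st_conj n).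
    transitivity ((quad D s0 t0 * quad D u v ^ n
                   - quad D s0 (- t0) * quad D u (- v) ^ n) * c); [|ring].
    rewrite <- st_def, <- st_conj; unfold quad, c; rewrite opp_IZR; field; lra. }
auto using strong_benford_of_off_zeros.
Qed.
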